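(* For every $\varepsilon>0$ there exists an integer $m$ such that if an $m$-partite graph $G$ with nonempty vertex classes $V_1,\dots,V_m$ satisfies \[ \sum_{x\in V_i} d_j(x)^2\ \ge\ \bigl(\tfrac14+\varepsilon\bigr)|V_i|\,|V_j|^2 \] whenever $1\le i<j\le m$, then $G$ contains a triangle.
   Context: An $m$-partite graph $G=(V,E)$ has vertex set partitioned as $V=V_1\cup\dots\cup V_m$ (disjoint) with no edges inside any $V_i$. For a vertex $x\in V$ and $j\in[m]$, $d_j(x)$ denotes the number of neighbours of $x$ in $V_j$. *)

(* Defs.v *)
From mathcomp Require Import all_boot all_order all_algebra.
From mathcomp Require Import reals.

Set Implicit Arguments.
Unset Strict Implicit.
Unset Printing Implicit Defensive.

Definition simple_graph (T : finType) (e : rel T) : Prop :=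
  symmetric e /\ irreflexive e.

(* The classes are indexed from 0: [V i] is V_{i+1} in 1-based numbering. *)
Definition multipartite (T : finType) (e : rel T) (m : nat)
    (V : 'I_m -> {set T}) : Prop :=
  [/\ \bigcup_(i < m) V i = [set: T],
      (forall i j : 'I_m, i != j -> [disjoint V i & V j])
    & (forall (i : 'I_m) (x y : T), x \in V i -> y \in V i -> ~~ e x y)].

Definition deg_in (T : finType) (e : rel T) (A : {set T}) (x : T) : nat :=
  #|[set y in A | e x y]|.

Definition has_triangle (T : finType) (e : rel T) : Prop :=
  exists x y z : T, [/\ e x y, e y z & e x z].

(* Main.v *)
(** Write f_k(x) = d_k(x) / |V_k|.  In a triangle-free graph, suppose that x
    satisfies f_k(x) >= a >= 1/2 for all k in a large index set J, and let j be
    the least element of J.  The neighbours y of x in V_j, which form at least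
    a fraction a of V_j, satisfy f_k(y) <= 1 - a for k in J.  If all the other
    y in V_j had mean square of f_k(y) over k in J at most about a^2, the mean
    of f_k(y)^2 over y and k would be at most about
    a (1 - a)^2 + (1 - a) a^2 = a (1 - a) <= 1/4, contrary to the hypothesis.
    So some y in V_j has f_k(y) >= a + eps/3 for a positive proportion of the
    k in J.  Iterating pushes a above 1, which is absurd. *)
Require Import Defs.
From mathcomp Require Import all_boot all_order all_algebra.
From mathcomp Require Import reals lra.
From mathcomp Require boolp.

Import Order.TTheory GRing.Theory Num.Theory.
Local Open Scope ring_scope.

(* For empty [A] the value is [0 / 0 = 0]. *)
Definition rel_deg (R : realType) (T : finType) (e : rel T) (A : {set T})
    (x : T) : R :=
  (deg_in e A x)%:R / #|A|%:R.
Arguments rel_deg R {T} e A x.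

Lemma deg_in_le_card (T : finType) (e : rel T) (A : {set T}) (x : T) :
  (deg_in e A x <= #|A|)%N.
Proof. by apply/subset_leq_card/subsetP => y; rewrite inE => /andP[]. Qed.

Lemma rel_deg_ge0 (R : realType) (T : finType) (e : rel T) (A : {set T})
    (x : T) : 0 <= rel_deg R e A x.
Proof. by rewrite divr_ge0. Qed.

Lemma rel_deg_le1 (R : realType) (T : finType) (e : rel T) (A : {set T})
    (x : T) : rel_deg R e A x <= 1.
Proof.
rewrite /rel_deg; have [->|A0] := eqVneq #|A| 0%N; first by rewrite invr0 mulr0.
by rewrite ler_pdivrMr ?ltr0n ?lt0n// mul1r ler_nat deg_in_le_card.
Qed.

(** A common neighbour of [x] and [y] would close a triangle, so their neighbourhoods in [A] are
    disjoint. *)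
Lemma rel_deg_adjacent (R : realType) (T : finType) (e : rel T) (A : {set T})
    (x y : T) : ~ has_triangle e -> e x y ->
  rel_deg R e A x + rel_deg R e A y <= 1.
Proof.
move=> noT exy; rewrite /rel_deg -mulrDl -natrD.
have [->|A0] := eqVneq #|A| 0%N; first by rewrite invr0 mulr0.
rewrite ler_pdivrMr ?ltr0n ?lt0n// mul1r ler_nat /deg_in.
rewrite -cardsUI [X in (_ + #|pred_of_set X|)%N](_ : _ = set0).
  rewrite cards0 addn0; apply/subset_leq_card/subsetP => z.
  by rewrite !inE => /orP[] /andP[].
apply/setP => z; rewrite !inE; apply/negP => /andP[/andP[_ exz] /andP[_ eyz]].
by apply: noT; exists x, y, z.
Qed.

(** Each [f k ^+ 2] is at most [c ^+ 2], plus 1 when [c <= f k]; summing over [J] leaves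
    [eta * #|J|] for the large values. *)
Lemma card_large_values (R : realFieldType) (I : finType) (J : {set I})
    (f : I -> R) (c eta : R) :
  0 <= c -> (forall k, 0 <= f k <= 1) ->
  (c ^+ 2 + eta) * #|J|%:R <= \sum_(k in J) f k ^+ 2 ->
  eta * #|J|%:R <= #|[set k in J | c <= f k]|%:R.
Proof.
move=> c0 f01 hsum.
have : \sum_(k in J) f k ^+ 2 <= \sum_(k in J) (c ^+ 2 + (c <= f k)%R%:R).
  apply: ler_sum => k _; have /andP[fk0 fk1] := f01 k.
  by case: (lerP c (f k)) => h /=; nra.
rewrite big_split /= sumr_const -natr_sum -mulr_natr.
rewrite (_ : (\sum_(k in J) (c <= f k)%R)%N = #|[set k in J | (c <= f k)%R]|).
  by lra.
rewrite -sum1_card big_mkcond [RHS]big_mkcond /=; apply: eq_bigr => k _.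
by rewrite inE; case: (k \in J) => //=; case: (c <= f k).
Qed.

Lemma natr_archi (R : realType) (eta : R) (n : nat) : 0 < eta ->
  exists N : nat, n%:R <= eta * N%:R.
Proof.
move=> eta0; exists (Num.bound (n%:R / eta)).
rewrite mulrC -ler_pdivrMr// ltW//.
by apply: archi_boundP; apply: divr_ge0 => //; apply: ltW.
Qed.

(** This is the degree hypothesis divided by [#|V j| ^ 2], which makes classes of different sizes
    comparable. *)
Definition square_dense (R : realType) (T : finType) (e : rel T) (m : nat)
    (V : 'I_m -> {set T}) (c : R) : Prop :=
  forall i j : 'I_m, (i < j)%N ->
    c * #|V i|%:R <= \sum_(x in V i) rel_deg R e (V j) x ^+ 2.
Arguments square_dense R {T} e {m} V c.

Definition rich_vertex (R : realType) (T : finType) (e : rel T) (m : nat)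
    (V : 'I_m -> {set T}) (a : R) (n : nat) : Prop :=
  exists (x : T) (J : {set 'I_m}),
    (n <= #|J|)%N /\ forall k, k \in J -> a <= rel_deg R e (V k) x.
Arguments rich_vertex R {T} e {m} V a n.

Lemma square_dense_sum (R : realType) (T : finType) (e : rel T) (m : nat)
    (V : 'I_m -> {set T}) (c : R) (j : 'I_m) (J : {set 'I_m}) :
  square_dense R e V c -> (forall k, k \in J -> (j < k)%N) ->
  c * #|V j|%:R * #|J|%:R
    <= \sum_(y in V j) \sum_(k in J) rel_deg R e (V k) y ^+ 2.
Proof.
move=> dense jJ; rewrite exchange_big /= mulr_natr -sumr_const.
by apply: ler_sum => k kJ; apply: dense; apply: jJ.
Qed.

(** Start of the iteration: average over the first class. Triangle-freeness is not yet involved,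
    since 1/4 is the square of 1/2. *)
Lemma rich_vertex_half (R : realType) (eps : R) (n : nat) : 0 < eps ->
  exists M : nat, forall (m : nat) (T : finType) (e : rel T)
      (V : 'I_m -> {set T}), (M <= m)%N ->
    (forall i, V i != set0) -> square_dense R e V (4%:R^-1 + eps) ->
    rich_vertex R e V 2%:R^-1 n.
Proof.
move=> eps0; have [N hN] := natr_archi R eps n eps0.
(* The extra class is the first one, which supplies the vertex; at least [N] others remain for
   [J]. *)
exists N.+1 => -[//|m] T e V; rewrite ltnS => Nm V0 dense.
pose J := [set k : 'I_m.+1 | (0 < k)%N].
have cardJ : #|J| = m.
  rewrite (_ : J = ~: [set ord0]); first by rewrite cardsC1 card_ord.
  by apply/setP => k; rewrite !inE -val_eqE /= lt0n.
have hJ k : k \in J -> ((ord0 : 'I_m.+1) < k)%N by rewrite inE.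
have := square_dense_sum _ _ _ _ _ _ ord0 J dense hJ.
case: (boolP [exists y in V ord0, (2%:R^-1 ^+ 2 + eps) * #|J|%:R
         <= \sum_(k in J) rel_deg R e (V k) y ^+ 2]) => [|/exists_inPn hy].
  move=> /exists_inP[y yV hy] _; exists y.
  exists [set k in J | 2%:R^-1 <= rel_deg R e (V k) y]; split; last first.
    by move=> k; rewrite inE => /andP[].
  rewrite -(ler_nat R); apply: le_trans hN _.
  apply: (@le_trans _ _ (eps * #|J|%:R)).
    by rewrite ler_pM2l// ler_nat cardJ.
  apply: card_large_values hy => [|k]; first by lra.
  by rewrite rel_deg_ge0 rel_deg_le1.
rewrite leNgt => /negP[]; rewrite mulrAC mulr_natr -sumr_const.
have /set0Pn[y0 y0V] := V0 ord0.
apply: ltr_sum; first by apply/hasP; exists y0; rewrite ?mem_index_enum.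
move=> y /hy; rewrite -ltNge => /lt_le_trans; apply.
by apply: ler_wpM2r => //; lra.
Qed.

(** In [N.+2], one index is spent on [j], and the other keeps the remaining set [K] nonempty even
    when [N] is 0. *)
Lemma rich_vertex_step (R : realType) (T : finType) (e : rel T) (m : nat)
    (V : 'I_m -> {set T}) (eps a : R) (n N : nat) :
  0 < eps -> eps <= 1 -> 2%:R^-1 <= a ->
  (forall i, V i != set0) -> square_dense R e V (4%:R^-1 + eps) ->
  ~ has_triangle e -> n%:R <= eps / 2%:R * N%:R ->
  rich_vertex R e V a N.+2 -> rich_vertex R e V (a + eps / 3%:R) n.
Proof.
move=> eps0 eps1 a2 V0 dense noT hN [x [J [NJ xJ]]].
have /card_gt0P[j0 j0J] : (0 < #|J|)%N by apply: leq_trans NJ.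
(* The density hypothesis only concerns pairs in increasing order, hence the least index. *)
case: (arg_minnP (P := fun k => k \in J) (fun k : 'I_m => k : nat) j0J) => j jJ jmin.
pose K := J :\ j.
have hK k : k \in K -> (j < k)%N.
  rewrite !inE => /andP[kj kJ]; rewrite ltn_neqAle jmin// andbT.
  by rewrite eq_sym.
have NK : (N < #|K|)%N by move: NJ; rewrite (cardsD1 j) jJ.
have K0 : 0 < #|K|%:R :> R by rewrite ltr0n (leq_trans _ NK).
have := square_dense_sum _ _ _ _ _ _ j K dense hK.
(* A mean square of at least [B] forces values at least [c] on a proportion [eps / 2] of [K]. *)
set c := a + eps / 3%:R; set B := c ^+ 2 + eps / 2%:R.
case: (boolP [exists y in V j, B * #|K|%:R
         <= \sum_(k in K) rel_deg R e (V k) y ^+ 2]) => [|/exists_inPn hy].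
  move=> /exists_inP[y yV hy] _; exists y.
  exists [set k in K | c <= rel_deg R e (V k) y]; split; last first.
    by move=> k; rewrite inE => /andP[].
  rewrite -(ler_nat R); apply: le_trans hN _.
  apply: (@le_trans _ _ (eps / 2%:R * #|K|%:R)).
    by rewrite ler_wpM2l ?ler_nat ?(ltnW NK)//; lra.
  apply: card_large_values hy => [|k]; first by rewrite /c; lra.
  by rewrite rel_deg_ge0 rel_deg_le1.
rewrite leNgt => /negP[].
have Vj0 : 0 < #|V j|%:R :> R by rewrite ltr0n card_gt0.
set b := rel_deg R e (V j) x.
have ab : a <= b by apply: xJ.
have b1 : b <= 1 by apply: rel_deg_le1.
have degb : (deg_in e (V j) x)%:R = b * #|V j|%:R.
  by rewrite /b /rel_deg divfK// gt_eqF.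
(* Neighbours of [x] have mean square at most [(1 - a) ^+ 2], all other vertices less than [B]. *)
apply: (@le_lt_trans _ _
  (\sum_(y in V j) (B + (e x y)%:R * ((1 - a) ^+ 2 - B)) * #|K|%:R)).
  apply: ler_sum => y yV; case exy: (e x y); last first.
    by rewrite mul0r addr0 ltW// ltNge hy.
  rewrite mul1r addrC subrK mulr_natr -sumr_const.
  apply: ler_sum => k; rewrite inE => /andP[_ kJ].
  have := rel_deg_adjacent R T e (V k) x y noT exy.
  have := xJ k kJ; have := rel_deg_ge0 R T e (V k) y.
  by move=> *; rewrite ler_sqr ?nnegrE//; lra.
rewrite -mulr_suml ltr_pM2r// big_split /= sumr_const -mulr_suml -natr_sum.
rewrite (_ : (\sum_(y in V j) e x y)%N = deg_in e (V j) x); last first.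
  rewrite /deg_in -sum1_card big_mkcond [RHS]big_mkcond /=.
  by apply: eq_bigr => y _; rewrite inE; case: (y \in V j) => //=; case: (e x y).
rewrite degb -[B *+ _]mulr_natr [b * _ * _]mulrAC -mulrDl ltr_pM2r//.
have ltB : (1 - a) ^+ 2 <= B by rewrite /B /c; nra.
(* The coefficient of [b] is nonpositive, so the bound is weakest at [b = a]. *)
apply: (@le_lt_trans _ _ (B + a * ((1 - a) ^+ 2 - B))); first by nra.
have a1 : a <= 1 by lra.
(* The error is then at most [(1 - a) * 3/2 * eps <= 3/4 * eps], and [a * (1 - a) <= 1/4], so the
   total stays below [1/4 + eps]. *)
have BE : B <= a ^+ 2 + 3%:R / 2%:R * eps by rewrite /B /c; nra.
by nra.
Qed.

(** The induction on [s] keeps [n] general, because each step shrinks the index set and must start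
    from a larger one. *)
Lemma rich_vertex_iter (R : realType) (eps : R) (s n : nat) :
  0 < eps -> eps <= 1 ->
  exists M : nat, forall (m : nat) (T : finType) (e : rel T)
      (V : 'I_m -> {set T}), (M <= m)%N ->
    (forall i, V i != set0) -> square_dense R e V (4%:R^-1 + eps) ->
    ~ has_triangle e -> rich_vertex R e V (2%:R^-1 + eps / 3%:R * s%:R) n.
Proof.
move=> eps0 eps1; elim: s n => [|s IH] n.
  have [M hM] := rich_vertex_half R eps n eps0.
  by exists M => *; rewrite mulr0 addr0; apply: hM.
have [N hN] : exists N : nat, n%:R <= eps / 2%:R * N%:R.
  by apply: natr_archi; lra.
have [M hM] := IH N.+2; exists M => m T e V Mm V0 dense noT.
rewrite -[s.+1%:R]natr1 mulrDr mulr1 addrA.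
apply: rich_vertex_step hN _ => //; last exact: hM.
by rewrite lerDl mulr_ge0// divr_ge0// ltW.
Qed.

Theorem theorem2p1 (R : realType) (eps : R) (eps_gt0 : 0 < eps) :
  exists m : nat,
    forall (T : finType) (e : rel T) (V : 'I_m -> {set T}),
      simple_graph e ->
      multipartite e V ->
      (forall i : 'I_m, V i != set0) ->
      (forall i j : 'I_m, (i < j)%N ->
         (4%:R^-1 + eps) * #|V i|%:R * #|V j|%:R ^+ 2
           <= \sum_(x in V i) (deg_in e (V j) x)%:R ^+ 2) ->
      has_triangle e.
Proof.
(* Capping at 1 weakens the density condition and gives [d ^+ 2 <= d], used to bound [B]. *)
pose d := Num.min eps 1.
have d0 : 0 < d by rewrite lt_min eps_gt0 ltr01.
have d1 : d <= 1 by rewrite ge_min lexx orbT.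
(* After [s] steps the relative degree would be at least 3/2. *)
have [s hs] : exists s : nat, 1%:R <= d / 3%:R * s%:R.
  by apply: natr_archi; lra.
have [M hM] := rich_vertex_iter R d s 1 d0 d1.
exists M => T e V _ _ V0 hV.
have dense : square_dense R e V (4%:R^-1 + d).
  move=> i j ij; have Vj0 : 0 < #|V j|%:R :> R by rewrite ltr0n card_gt0.
  rewrite -(ler_pM2r (exprn_gt0 2 Vj0)) mulr_suml.
  apply: (@le_trans _ _ ((4%:R^-1 + eps) * #|V i|%:R * #|V j|%:R ^+ 2)).
    by rewrite !ler_wpM2r ?exprn_ge0// lerD2l ge_min lexx.
  apply: le_trans (hV i j ij) _; apply: ler_sum => x _.
  by rewrite -exprMn /rel_deg divfK// gt_eqF.
apply: boolp.contrapT => noT.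
have [x [J [/card_gt0P[k kJ] xJ]]] := hM M T e V (leqnn M) V0 dense noT.
by have := xJ k kJ; have := rel_deg_le1 R T e (V k) x; lra.
Qed.
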